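(* Let $\mathcal{S}:[0,1]\to\mathbb{R}_{>0}$ be continuous and convex. For any $\tau>0$, $x_0\in[0,1]$, $n_0\in\mathbb{N}$, $\lambda>\lambda_{\mathrm{eq}}^{\max}(\tau)$ and any task release control policy $u\in\mathcal{U}$, if $x_{\mathrm{th}}(\tau)<1$, then $$\limsup_{t\to+\infty} n_u(t,\tau,\lambda,x_0,n_0)=+\infty .$$
   Context: Dynamical queue. Identical tasks arrive periodically at a single server at rate $\lambda>0$ (a new task arrives every $1/\lambda$ time units) and are serviced in order of arrival. The server state $x(t)$ evolves by $\dot x(t)=(b(t)-x(t))/\tau$, $x(0)=x_0\in[0,1]$, where $\tau>0$ and $b(t)=1$ if the server is busy at time $t$ and $b(t)=0$ otherwise; $[0,1]$ is invariant. The service time function $\mathcal{S}:[0,1]\to\mathbb{R}_{>0}$ is continuous and convex: a task whose service begins when the server state is $x$ takes exactly time $\mathcal{S}(x)$ to service, during which the server is busy and cannot be interrupted. Task release control policy. A policy $u$ takes values $u(t)\in\{\mathrm{ON},\mathrm{OFF}\}$ for all $t\ge 0$; an outstanding task is assigned to the server if and only if the server is idle (not servicing a task) and $u=\mathrm{ON}$. $\mathcal{U}$ is the set of all such policies (they may depend on $\lambda$, $\mathcal{S}$, $x$, etc.). No task is dropped. $n_u(t,\tau,\lambda,x_0,n_0)$ denotes the queue length, i.e. the number of outstanding tasks awaiting service, at time $t$ under policy $u$, when the arrival rate is $\lambda$ and at time $0$ the server state is $x_0$ and the queue length is $n_0$. One-task equilibrium. For $x\in[0,1]$, $\tau>0$,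 $\lambda>0$ let $\mathcal{R}(x,\tau,\lambda):=\tau\log\bigl(1-(1-e^{1/(\lambda\tau)})x\bigr)$ and $x_{\mathrm{eq}}(\tau,\lambda):=\{x\in[0,1] : \mathcal{S}(x)=\mathcal{R}(x,\tau,\lambda)\}$. Define $\lambda_{\mathrm{eq}}^{\max}(\tau):=\max\{\lambda>0 : x_{\mathrm{eq}}(\tau,\lambda)\neq\emptyset\}$ (the maximum exists). The set $x_{\mathrm{eq}}(\tau,\lambda_{\mathrm{eq}}^{\max}(\tau))$ has exactly one element, denoted $x_{\mathrm{th}}(\tau)$. *)

(* Defs.v *)
From HB Require Import structures.
From mathcomp Require Import all_boot all_order all_algebra finmap.
From mathcomp Require Import all_classical all_reals all_analysis.

Set Implicit Arguments.
Unset Strict Implicit.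
Unset Printing Implicit Defensive.

Import Order.TTheory GRing.Theory Num.Theory.
Import numFieldNormedType.Exports.

Local Open Scope classical_set_scope.
Local Open Scope ring_scope.

(* A service time function is a total map S : R -> R of which only the values
   on [0, 1] are ever constrained or used. *)
Definition service_time (R : realType) (S : R -> R) : Prop :=
  [/\ forall x, x \in `[0, 1] -> 0 < S x,
      {within `[0, 1], continuous S} &
      convex_function (`[0, 1]%classic : set R) S].

Definition Rcal (R : realType) (x tau lambda : R) : R :=
  tau * ln (1 - (1 - expR (1 / (lambda * tau))) * x).

Definition x_eq (R : realType) (S : R -> R) (tau lambda : R) : set R :=
  [set x | x \in `[0, 1] /\ S x = Rcal x tau lambda].

(* get picks an element of a nonempty set.  Both sets below are singletons when
   S is a service time function and 0 < tau. *)
Definition lambda_eq_max (R : realType) (S : R -> R) (tau : R) : R :=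
  let admissible := [set l : R | 0 < l /\ x_eq S tau l !=set0] in
  get [set l | admissible l /\ ubound admissible l].

Definition x_th (R : realType) (S : R -> R) (tau : R) : R :=
  get (x_eq S tau (lambda_eq_max S tau)).

Inductive switch := ON | OFF.

(* The decision at time t may depend on t and on the trajectories of the server
   state and of the queue length.  Dependence on S, tau, lambda, x0, n0 is
   allowed by quantifying over the policy after these data. *)
Definition release_policy (R : realType) : Type :=
  (R -> R) -> (R -> nat) -> R -> switch.

Section evolution.
Context {R : realType}.
Variables (S : R -> R) (tau lambda x0 : R) (n0 : nat) (u : release_policy R).
Variables (x : R -> R) (starts : set R) (n : R -> nat).
(* x is the server state, n the queue length, and starts the set of times at
   which a task is assigned to the server. *)

Definition busy : set R :=
  [set t | exists2 s, starts s & s <= t < s + S (x s)].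

(* A task begun strictly before t is still in service at t, so that nothing can
   be assigned at t.  This excludes a task begun at t itself, which counts for
   busy. *)
Definition occupied : set R :=
  [set t | exists2 s, starts s & s < t < s + S (x s)].

(* Tasks arrive at the times k / lambda, k >= 1, so that lambda * t rounded down
   have arrived in ]0, t]; those present at time 0 are counted by n0, which
   arrived_by includes. *)
Definition arrived_by (t : R) : nat := (n0 + Num.truncn (lambda * t))%N.

(* fset_set sends infinite sets to the empty one, hence the finiteness clause
   in queue_evolution. *)
Definition num_starts (A : set R) : nat := #|` fset_set (starts `&` A)|.

(* (x, starts, n) is an evolution of the dynamical queue under the policy u.
   The state equation is imposed where b = \1_busy is locally constant, together
   with continuity of x, since x has no derivative at the switching times.
   Under a policy whose ON times have no first one while a task is waiting (ON
   exactly on ]1, 2[, say) the assignment rule may leave no evolution at all. *)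
Definition queue_evolution : Prop :=
  [/\ [/\ x 0 = x0,
          {within `[0, +oo[, continuous x} &
          forall t : R, 0 < t -> (\forall r \near t, \1_busy r = \1_busy t :> R) ->
            is_derive t (1 : R) x ((\1_busy t - x t) / tau)],
      starts `<=` `[0, +oo[ /\
        (forall t : R, finite_set (starts `&` `[0, t])),
      forall t : R, 0 <= t ->
        (starts t <->
         [/\ ~ occupied t,
             u x n t = ON &
             (num_starts `[0%R, t[ < arrived_by t)%N]) &
      forall t : R, 0 <= t -> (n t + num_starts `[0%R, t] = arrived_by t)%N].

End evolution.

(* Main.v *)
(* Put [w t = expR (t / tau) * x t].  It is constant while the server idles and
   gains [expR (s / tau) * (expR (S (x s) / tau) - 1)] over a task started at
   [s], which is at least [(q - 1) * w s] for [q = expR (1 / (lmax * tau))],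
   where [lmax] is the maximal equilibrium rate.  So [w] grows by a factor [q]
   per task, whereas [w t <= expR (t / tau)] since [x t <= 1].  Hence at most
   [lmax * t + C] tasks have started by time [t], and the queue grows at least
   like [(lambda - lmax) * t]. *)
Require Import Defs.
From HB Require Import structures.
From mathcomp Require Import all_boot all_order all_algebra finmap.
From mathcomp Require Import all_classical all_reals all_analysis.
From mathcomp Require Import ring lra.

Import Order.TTheory GRing.Theory Num.Theory.
Import numFieldNormedType.Exports.

Local Open Scope classical_set_scope.
Local Open Scope ring_scope.

(** * Compactness and the maximal equilibrium rate *)

Lemma finite_set_max {R : realType} {A : set R} :
  finite_set A -> A !=set0 -> exists2 s, A s & forall r, A r -> r <= s.
Proof.
move=> finA [a Aa].
have [c cA maxc] := compact_EVT_max (f := id) (ex_intro _ a Aa)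
  (finite_compact finA) (continuous_subspaceT (fun=> cvg_id)).
exists c; first by rewrite inE in cA.
by move=> r Ar; apply: maxc; rewrite inE.
Qed.

(** Positivity of [S] keeps the denominator away from zero on [0, 1]. *)
Lemma service_gain_continuous {R : realType} {S : R -> R} {tau : R} :
  service_time S -> 0 < tau ->
  {within `[0, 1], continuous (fun x => x / (expR (S x / tau) - 1))}.
Proof.
move=> [S_gt0 S_cont _] tau_gt0.
have Ginv : {within `[0, 1], continuous (fun x => (expR (S x / tau) - 1)^-1)}.
  apply: (within_continuous_comp _ _ (fun y : R => (expR (y / tau) - 1)^-1)) => //.
  move=> y; rewrite inE => -[x /= x01 <-].
  have Sx_gt0 : 0 < S x / tau by rewrite divr_gt0// S_gt0.
  apply: cvgV; first by rewrite gt_eqF // subr_gt0 expR_gt1.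
  apply: cvgB; last exact: cvg_cst.
  by apply: continuous_comp; [exact: mulrr_continuous|exact: continuous_expR].
have idc : {within `[0, 1 : R], continuous id}.
  by apply: continuous_subspaceT => ?; exact: cvg_id.
by move=> x; apply: cvgM; [exact: idc|exact: Ginv].
Qed.

(* At an equilibrium [expR (S x / tau) - 1] equals [x] times the factor on the
   left, so [lambda_eq_max] is attained at the maximum of the continuous
   function [x / (expR (S x / tau) - 1)] on [0, 1]. *)
Lemma lambda_eq_max_bound {R : realType} {S : R -> R} {tau : R} :
  service_time S -> 0 < tau ->
  0 < lambda_eq_max S tau /\
  forall x, x \in `[0, 1] ->
    x * (expR (1 / (lambda_eq_max S tau * tau)) - 1) <= expR (S x / tau) - 1.
Proof.
move=> hS tau_gt0; have [S_gt0 _ _] := hS.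
have [m m01 maxm] := EVT_max ler01 (service_gain_continuous hS tau_gt0).
have E_gt0 x : x \in `[0, 1] -> 0 < expR (S x / tau) - 1.
  by move=> x01; rewrite subr_gt0 expR_gt1 divr_gt0// S_gt0.
have one01 : (1 : R) \in `[0, 1] by rewrite in_itv /= ler01 lexx.
set H := m / (expR (S m / tau) - 1) in maxm.
(* Comparison with the value at 1, which is positive; this also excludes [m = 0]. *)
have H_gt0 : 0 < H.
  by apply: lt_le_trans (maxm 1 one01); rewrite divr_gt0// E_gt0.
have m_gt0 : 0 < m by move: H_gt0; rewrite /H pmulr_lgt0// invr_gt0 E_gt0.
have lnH_gt0 : 0 < ln (1 + H^-1) by rewrite ln_gt0// ltrDl invr_gt0.
pose adm := [set l : R | 0 < l /\ x_eq S tau l !=set0].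
(* The witness is the rate [l] solving [expR (1 / (l * tau)) - 1 = H^-1], for which [m] is an
   equilibrium. *)
have adm_max : [set l | adm l /\ ubound adm l] (tau * ln (1 + H^-1))^-1.
  split.
    split; first by rewrite invr_gt0 mulr_gt0.
    exists m; split => //; rewrite /Rcal.
    have -> : 1 / ((tau * ln (1 + H^-1))^-1 * tau) = ln (1 + H^-1).
      by field; rewrite !gt_eqF.
    rewrite lnK ?posrE ?addr_gt0 ?invr_gt0//.
    have -> : 1 - (1 - (1 + H^-1)) * m = expR (S m / tau).
      by rewrite /H invf_div; field; rewrite gt_eqF.
    by rewrite expRK mulrCA divff ?mulr1// gt_eqF.
  move=> l [l_gt0 [x [x01 Sx]]].
  have /= x_ge0 : 0 <= x by move: x01; rewrite in_itv => /andP[].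
  have lt_gt0 : 0 < l * tau by rewrite mulr_gt0.
  have F_gt0 : 0 < expR (1 / (l * tau)) - 1 by rewrite subr_gt0 expR_gt1 divr_gt0.
  (* Exponentiating the equilibrium equation: the function maximised by [m] takes at [x] the value
     [(expR (1 / (l * tau)) - 1)^-1], which is thus at most [H]. *)
  have Ex : expR (S x / tau) - 1 = (expR (1 / (l * tau)) - 1) * x.
    rewrite Sx /Rcal [_ / tau]mulrC mulKf ?gt_eqF// lnK; first by ring.
    by rewrite posrE -mulNr opprB ltr_wpDr// mulr_ge0// ltW.
  have x_gt0 : 0 < x by have := E_gt0 x x01; rewrite Ex pmulr_rgt0.
  have := maxm x x01; rewrite Ex invfM mulrCA divff ?gt_eqF// mulr1.
  rewrite -[X in _ <= X]invrK lef_pV2 ?posrE ?invr_gt0//.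
  rewrite lerBrDl => Hle.
  have lnle : tau * ln (1 + H^-1) <= l^-1.
    have -> : l^-1 = tau * (1 / (l * tau)) by field; rewrite !gt_eqF.
    rewrite ler_pM2l// -[X in _ <= X]expRK ler_ln// posrE ?expR_gt0//.
    by rewrite addr_gt0// invr_gt0.
  by rewrite -[X in X <= _]invrK lef_pV2// posrE ?invr_gt0// mulr_gt0.
have [[L_gt0 L_adm] L_ub] := getI adm_max.
rewrite -[get _]/(lambda_eq_max S tau) in L_gt0 L_adm L_ub *; split => // x x01.
have x_ge0 : 0 <= x by move: x01; rewrite in_itv => /andP[].
have [->|x_neq0] := eqVneq x 0; first by rewrite mul0r ltW// E_gt0// in_itv /= lexx ler01.
have x_gt0 : 0 < x by rewrite lt_def x_neq0.
(* The chosen maximum dominates the explicit rate, which bounds its exponential by [1 + H^-1]. *)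
have {}L_ub := L_ub _ adm_max.1.
have : expR (1 / (lambda_eq_max S tau * tau)) <= 1 + H^-1.
  rewrite -[leRHS]lnK ?posrE ?addr_gt0 ?invr_gt0// ler_expR.
  rewrite div1r invfM ler_pdivrMr// mulrC -[leRHS]invrK lef_pV2//.
  by rewrite posrE invr_gt0 mulr_gt0.
have := maxm x x01; rewrite ler_pdivrMr ?E_gt0// => xH qH.
rewrite -(ler_pM2l H_gt0); apply: le_trans xH.
rewrite mulrCA -[leRHS]mulr1 ler_pM2l//.
by rewrite mulrC -ler_pdivlMr// [1 / H]div1r lerBlDl.
Qed.

(** * The state equation along an evolution *)

Section evolution.
Context {R : realType} {S : R -> R} {tau lambda x0 : R} {n0 : nat}.
Context {u : release_policy R} {x : R -> R} {starts : set R} {n : R -> nat}.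
Hypothesis hS : service_time S.
Hypothesis tau_gt0 : 0 < tau.
Hypothesis hx0 : 0 <= x0 <= 1.
Hypothesis evol : queue_evolution S tau lambda x0 n0 u x starts n.

Local Notation num_starts := (num_starts starts).
Local Notation occupied := (occupied S x starts).
Local Notation busy := (busy S x starts).

(** With the integrating factor [expR (t / tau)], constant input [beta] makes the derivative vanish
    on the open interval; continuity carries the equality to the endpoints, where the input may
    switch. *)
Lemma state_evolution (a b beta : R) : 0 <= a -> a <= b ->
  (forall r, a < r < b -> \1_busy r = beta) ->
  expR (b / tau) * (x b - beta) = expR (a / tau) * (x a - beta).
Proof.
move=> a_ge0 leab busyE; have [[_ x_cont x_derive] _ _ _] := evol.
pose f t := expR (t / tau) * (x t - beta).
have [c _] : exists2 c, c \in `[a, b]%R & f b - f a = 0 * (b - a).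
  apply: (@MVT_segment _ f (fun=> 0)) => // [t|].
    rewrite in_itv /= => /andP[at_ tb].
    have t_gt0 : 0 < t by exact: le_lt_trans at_.
    have : is_derive t (1 : R) x ((\1_busy t - x t) / tau).
      apply: x_derive => //.
      have : \forall r \near t, r \in `]a, b[ by apply: near_in_itvoo; rewrite in_itv /= at_.
      apply: filterS => r; rewrite in_itv /= => rab.
      by rewrite !busyE// at_.
    rewrite busyE ?at_// => dx.
    apply: is_derive_eq.
    by rewrite /GRing.scale /=; field; rewrite gt_eqF.
  have xab : {within `[a, b], continuous x}.
    apply: continuous_subspaceW x_cont => t /=.
    by rewrite !in_itv /= andbT => /andP[/(le_trans a_ge0)].
  have Eab : {within `[a, b], continuous (fun t : R => expR (t / tau))}.
    apply: continuous_subspaceT => t.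
    by apply: continuous_comp; [exact: mulrr_continuous|exact: continuous_expR].
  move=> t; apply: cvgM; first exact: Eab.
  by apply: cvgB; [exact: xab|exact: cvg_cst].
by rewrite mul0r => /subr0_eq.
Qed.

(** * Counting starts *)

Lemma finite_starts_co (t : R) : finite_set (starts `&` `[0, t[).
Proof.
have [_ [_ fin] _ _] := evol.
apply: sub_finite_set (fin t) => r [? /=]; rewrite !in_itv /= => /andP[-> /ltW ->].
by [].
Qed.

(** Removing the largest start [s] from the downward closed [A] leaves exactly the starts in [[0,
    s[]. This drives the inductions on the number of starts; a general [A] covers both [[0, t[] and
    [[0, t]]. *)
Lemma num_starts_last {A : set R} {k : nat} : finite_set (starts `&` A) ->
  A `<=` `[0, +oo[ -> (forall r s, 0 <= r < s -> A s -> A r) ->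
  num_starts A = k.+1 ->
  exists s, [/\ starts s, A s, num_starts `[0, s[ = k &
    forall r, starts r -> A r -> r <= s].
Proof.
move=> finA A_ge0 A_down cardA.
have [||s [ss As] maxs] := @finite_set_max _ (starts `&` A) => //.
  apply/set0P/eqP => A0; move: cardA.
  by rewrite /Defs.num_starts A0 fset_set0 cardfs0.
exists s; split => //; last by move=> r sr Ar; exact: maxs.
apply: succn_inj; rewrite -cardA /Defs.num_starts.
have -> : starts `&` A = s |` (starts `&` `[0, s[).
  apply/seteqP; split => [r [sr Ar]|r [->//|[sr /=]]].
    have : 0 <= r by have := A_ge0 _ Ar; rewrite /= in_itv /= andbT.
    have := maxs r (conj sr Ar); rewrite le_eqVlt => /predU1P[->|rs r0]; first by left.
    by right; split => //=; rewrite in_itv /= r0.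
  by rewrite in_itv /= => rs; split => //; exact: A_down rs As.
rewrite fset_setU1; last exact: finite_starts_co.
rewrite cardfsU1 in_fset_set; last exact: finite_starts_co.
by rewrite memNset// => -[_ /=]; rewrite in_itv /= ltxx andbF.
Qed.

Lemma num_starts_last_co {t : R} {k : nat} : num_starts `[0, t[ = k.+1 ->
  exists s, [/\ starts s, 0 <= s < t, num_starts `[0, s[ = k &
    forall r, starts r -> 0 <= r < t -> r <= s].
Proof.
move=> cardt; have [| | | |s [ss st cards maxs]] := @num_starts_last `[0, t[ k => //.
- exact: finite_starts_co.
- by move=> r /=; rewrite !in_itv /= andbT => /andP[].
- move=> r s /andP[r0 rs] /=; rewrite !in_itv /= r0 => /andP[_].
  exact: lt_trans.
by exists s; split => // r sr rt; apply: maxs => //=; rewrite in_itv.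
Qed.

Lemma num_starts_last_cc {t : R} {k : nat} : num_starts `[0, t] = k.+1 ->
  exists s, [/\ starts s, 0 <= s <= t & num_starts `[0, s[ = k].
Proof.
have [_ [_ fin] _ _] := evol.
move=> cardt; have [| | | |s [ss st cards maxs]] := @num_starts_last `[0, t] k => //.
- by move=> r /=; rewrite !in_itv /= andbT => /andP[].
- move=> r s /andP[r0 rs] /=; rewrite !in_itv /= r0 => /andP[_].
  by move=> st; rewrite ltW// (lt_le_trans rs).
by exists s.
Qed.

Lemma start_ge0 {s : R} : starts s -> 0 <= s.
Proof. by have [_ [sub _] _ _] := evol => /sub /=; rewrite in_itv /= andbT. Qed.

Lemma start_not_occupied {s : R} : starts s -> ~ occupied s.
Proof.
have [_ _ rule _] := evol => ss.
by have /(rule _ (start_ge0 ss))[] := ss.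
Qed.

(** * The weighted state at unoccupied times: value, range and growth *)

Lemma state_before_first {t : R} : 0 <= t -> num_starts `[0, t[ = 0%N ->
  expR (t / tau) * x t = x0.
Proof.
have [[x_0 _ _] _ _ _] := evol => t_ge0 cardt.
have := @state_evolution 0 t 0 (lexx 0) t_ge0.
rewrite !subr0 mul0r expR0 mul1r x_0; apply => r /andP[r0 rt].
rewrite indicE memNset// => -[s ss /andP[sr _]].
have : s \in fset_set (starts `&` `[0, t[).
  rewrite in_fset_set; last exact: finite_starts_co.
  by rewrite inE; split => //=; rewrite in_itv /= start_ge0// (le_lt_trans sr).
by move/eqP: cardt; rewrite cardfs_eq0 => /eqP ->; rewrite inE.
Qed.

(** The input is 1 during the task begun at [s] and 0 from its end up to [t], so [state_evolution]
    applies to each phase in turn. *)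
Lemma state_after_last {s t : R} : starts s -> s < t -> 0 < S (x s) ->
  (forall r, starts r -> 0 <= r < t -> r <= s) -> ~ occupied t ->
  s + S (x s) <= t /\
  expR (t / tau) * x t =
    expR (s / tau) * x s + expR (s / tau) * (expR (S (x s) / tau) - 1).
Proof.
move=> ss st Sx_gt0 lasts freet; have s_ge0 := start_ge0 ss.
have end_le : s + S (x s) <= t.
  by rewrite leNgt; apply/negP => te; apply: freet; exists s; rewrite ?st.
split => //.
have during : expR ((s + S (x s)) / tau) * (x (s + S (x s)) - 1) =
    expR (s / tau) * (x s - 1).
  apply: state_evolution => //; first by rewrite lerDl ltW.
  move=> r /andP[sr re]; rewrite indicE mem_set//.
  by exists s; rewrite // (ltW sr).
have after : expR (t / tau) * (x t - 0) =
    expR ((s + S (x s)) / tau) * (x (s + S (x s)) - 0).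
  apply: state_evolution => //; first by rewrite addr_ge0// ltW.
  move=> r /andP[er rt]; rewrite indicE memNset// => -[s' ss' /andP[sr' re']].
  (* A task in service at [r] began at some [s' <= s]. If [s' = s], it has already ended; if
     [s' < s], it would occupy the server at [s], where a task was assigned. *)
  have := lasts s' ss'; rewrite start_ge0// (le_lt_trans sr')// => /(_ isT).
  rewrite le_eqVlt => /predU1P[s'E|s's].
    by move: re'; rewrite s'E ltNge (ltW er).
  apply: (start_not_occupied ss); exists s' => //; rewrite s's /=.
  by apply: lt_trans re'; apply: lt_trans er; rewrite ltrDl.
move: during after; rewrite !subr0 mulrDl expRD => during ->.
by rewrite -(addrK (-1) (x (_ + _))) [RHS]/= mulrDr during; ring.
Qed.

(** By induction on the number of earlier starts: the state at the last start lies in [0, 1], so its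
    service time is positive and [state_after_last] applies. *)
Lemma state_free_itv {k : nat} {t : R} : 0 <= t -> num_starts `[0, t[ = k ->
  ~ occupied t -> 0 <= x t <= 1.
Proof.
have [S_gt0 _ _] := hS.
have et_gt0 r : 0 < expR (r / tau) := expR_gt0 _.
elim: k t => [|k IHk] t t_ge0 cardt freet.
  have xt := state_before_first t_ge0 cardt.
  rewrite -(pmulr_rge0 _ (et_gt0 t)) xt -[x t <= 1](ler_pM2l (et_gt0 t)) xt mulr1.
  case/andP: hx0 => -> /le_trans -> //.
  by rewrite -expR0 ler_expR divr_ge0// ltW.
have [s [ss /andP[s0 st] cards lasts]] := num_starts_last_co cardt.
have x01 := IHk s s0 cards (start_not_occupied ss).
have Sx_gt0 : 0 < S (x s) by rewrite S_gt0// in_itv.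
have [end_le xt] := state_after_last ss st Sx_gt0 lasts freet.
have E_gt0 : 0 < expR (S (x s) / tau) - 1 by rewrite subr_gt0 expR_gt1 divr_gt0.
case/andP: x01 => xs0 xs1.
rewrite -(pmulr_rge0 _ (et_gt0 t)) xt -[x t <= 1](ler_pM2l (et_gt0 t)) xt mulr1.
rewrite addr_ge0 ?mulr_ge0 ?(ltW E_gt0) ?(ltW (et_gt0 _))//=.
(* As [x s <= 1], the weighted state is at most its bound at the end of the last task, which
   precedes [t]. *)
have : expR ((s + S (x s)) / tau) <= expR (t / tau) by rewrite ler_expR ler_pM2r ?invr_gt0.
apply: le_trans; rewrite mulrDl expRD -mulrDr ler_pM2l//.
by rewrite addrCA gerDl subr_le0.
Qed.

Lemma start_state_itv {s : R} : starts s -> x s \in `[0, 1].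
Proof.
move=> ss; rewrite in_itv /=.
exact: state_free_itv (start_ge0 ss) erefl (start_not_occupied ss).
Qed.

(** The first task contributes at least [c], which starts the growth even from state 0; each later
    one multiplies the weighted state by at least [q]. Hence exponent [k] for [k.+1] starts. *)
Lemma state_growth {c q : R} : 0 <= c ->
  (forall y, y \in `[0, 1] -> c <= expR (S y / tau) - 1) ->
  (forall y, y \in `[0, 1] -> y * (q - 1) <= expR (S y / tau) - 1) -> 0 <= q ->
  forall k t, num_starts `[0, t[ = k.+1 -> ~ occupied t ->
    c * q ^+ k <= expR (t / tau) * x t.
Proof.
have [S_gt0 _ _] := hS => c_ge0 cE qE q_ge0; elim=> [|k IHk] t cardt freet;
  have [s [ss /andP[s0 st] cards lasts]] := num_starts_last_co cardt;
  have x01 := start_state_itv ss;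
  have [_ ->] := state_after_last ss st (S_gt0 _ x01) lasts freet.
  rewrite expr0 mulr1 -[c]add0r lerD//.
    by rewrite mulr_ge0 ?expR_ge0//; move: x01; rewrite in_itv => /andP[].
  rewrite -[c]mul1r ler_pM ?cE// -expR0 ler_expR divr_ge0// ltW//.
have IH := IHk s cards (start_not_occupied ss).
apply: (@le_trans _ _ (expR (s / tau) * x s * q)).
  by rewrite exprSr mulrA ler_wpM2r.
by rewrite -mulrA -mulrDr ler_wpM2l ?expR_ge0// -lerBlDl -{2}[x s]mulr1 -mulrBr qE.
Qed.

(** * Linear bound on the number of starts *)

Lemma num_starts_le : exists C, forall t, 0 <= t ->
  (num_starts `[0, t])%:R <= lambda_eq_max S tau * t + C.
Proof.
have [S_gt0 S_cont _] := hS.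
have [L_gt0 qE] := lambda_eq_max_bound hS tau_gt0.
set L := lambda_eq_max S tau in L_gt0 qE *.
have [m m01 minS] := EVT_min ler01 S_cont.
pose c := expR (S m / tau) - 1.
have c_gt0 : 0 < c by rewrite subr_gt0 expR_gt1 divr_gt0// S_gt0.
have cE y : y \in `[0, 1] -> c <= expR (S y / tau) - 1.
  by move=> y01; rewrite lerD2r ler_expR ler_pM2r ?invr_gt0// minS.
have Lt_gt0 : 0 < L * tau by rewrite mulr_gt0.
(* Taking logarithms in [c * q ^+ k <= expR (t / tau)] gives [k <= L * t - L * tau * ln c] for
   [k.+2] starts; the absolute value keeps the constant nonnegative, for at most one start. *)
exists (2 + `|L * tau * ln c|) => t t_ge0.
have Lt0 : 0 <= L * t by rewrite mulr_ge0// ltW.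
have lnc := ler_norm (- (L * tau * ln c)); rewrite normrN in lnc.
have lnc_ge0 := normr_ge0 (L * tau * ln c).
case cardt: (num_starts `[0, t]) => [|[|k]]; [by lra|by lra|].
have [s [ss /andP[s0 st] cards]] := num_starts_last_cc cardt.
(* Growth is evaluated at the last start [s], since the server may be occupied at [t] itself; this
   costs one start. *)
have := state_growth (ltW c_gt0) cE qE (expR_ge0 _) _ _ cards (start_not_occupied ss).
rewrite -expRM_natl => growth.
have : c * expR (k%:R * (1 / (L * tau))) <= expR (t / tau).
  apply: le_trans growth _; rewrite -[leRHS]mulr1.
  apply: ler_pM; rewrite ?expR_ge0//.
  - by have := start_state_itv ss; rewrite in_itv => /andP[].
  - by rewrite ler_expR ler_pM2r ?invr_gt0.
  - by have := start_state_itv ss; rewrite in_itv => /andP[].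
rewrite -[c in c * _]lnK ?posrE// -expRD ler_expR => /(ler_wpM2l (ltW Lt_gt0)).
have -> : L * tau * (ln c + k%:R * (1 / (L * tau))) = L * tau * ln c + k%:R.
  by field; rewrite !gt_eqF.
have -> : L * tau * (t / tau) = L * t by field; rewrite gt_eqF.
by rewrite -[k.+2]addn2 natrD; lra.
Qed.

End evolution.

(** * Divergence of the queue length *)

Theorem mainTheorem1 (R : realType) (S : R -> R) (hS : service_time S)
    (tau : R) (htau : 0 < tau) (x0 : R) (hx0 : 0 <= x0 <= 1) (n0 : nat)
    (lambda : R) (hlambda : lambda_eq_max S tau < lambda)
    (u : release_policy R) (hth : x_th S tau < 1)
    (x : R -> R) (starts : set R) (n : R -> nat)
    (hn : queue_evolution S tau lambda x0 n0 u x starts n) :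
  limf_esup (fun t : R => ((n t)%:R : R)%:E) +oo%R = +oo%E.
Proof.
have [C startsC] := num_starts_le hS htau hx0 hn.
have [_ _ _ balance] := hn.
have gap_gt0 : 0 < lambda - lambda_eq_max S tau by rewrite subr_gt0.
(* The upper limit is an infimum of suprema over neighbourhoods of infinity, so it suffices that [n]
   is unbounded on each half-line beyond [M]. *)
apply/ereal_inf_pinfty => _ [V [M [_ MV]] <-] /=.
rewrite -image_comp; apply: hasNub_ereal_sup; last first.
  by exists (n (M + 1))%:R, (M + 1) => //; apply: MV; rewrite ltrDl.
case=> B ubB.
(* Besides exceeding [M], [t] makes the linear surplus at least [B + C + 2]; after subtracting [C]
   and less than one for truncating the arrivals, the queue still exceeds [B]. *)
pose t := Num.max (Num.max 0 (M + 1)) ((B + C + 2) / (lambda - lambda_eq_max S tau)).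
have t_ge0 : 0 <= t by rewrite !le_max lexx.
have : (n t)%:R <= B.
  apply: ubB; exists t => //; apply: MV.
  by rewrite !lt_max ltrDl ltr01 orbT.
have tB : B + C + 2 <= (lambda - lambda_eq_max S tau) * t.
  by rewrite mulrC -ler_pdivrMr// le_max lexx orbT.
have := startsC t t_ge0.
have /(congr1 (fun k => k%:R : R)) := balance t t_ge0.
rewrite /arrived_by !natrD.
have := truncnS_gt (lambda * t); rewrite -natr1.
have : 0 <= (n0%:R : R) by [].
by move: tB; lra.
Qed.
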